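(* Let $X$ be a nonempty set and let $(Y,\|\cdot\|)$ be a Banach space with the fixed point property (FPP). Let $T,S:X\to Y$ be two mappings such that: (i) $T(X)$ is a closed convex subset of $Y$; (ii) $S(X)\subseteq T(X)$ and $\|S(x)-S(y)\|\le\|T(x)-T(y)\|$ for all $x,y\in X$; (iii) there exist $x_0\in X$ and $R>0$ such that, for every $x\in X$ with $\|T(x)-T(x_0)\|\ge R$, one has $S(x)-T(x_0)\neq\lambda\,(T(x)-T(x_0))$ for all $\lambda>1$. Then there exists at least one $x\in X$ such that $T(x)=S(x)$.
   Context: A mapping $h:D\to Y$ on a nonempty subset $D$ of a normed space $Y$ is nonexpansive if $\|h(x)-h(y)\|\le\|x-y\|$ for all $x,y\in D$. A Banach space $Y$ has the fixed point property (FPP) if every nonexpansive self-mapping of every nonempty closed convex bounded subset of $Y$ has a fixed point. *)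

(* Defs.v *)
From mathcomp Require Import all_boot all_order all_algebra.
From mathcomp Require Import all_classical all_reals all_analysis.

Set Implicit Arguments.
Unset Strict Implicit.
Unset Printing Implicit Defensive.

Import Order.TTheory GRing.Theory Num.Theory.
Import numFieldNormedType.Exports.

Local Open Scope classical_set_scope.
Local Open Scope ring_scope.

(* A mapping D -> Y is represented by a total function h : Y -> Y of which only
   the values on D matter. *)
Definition nonexpansive (R : realType) (Y : normedModType R)
    (D : set Y) (h : Y -> Y) : Prop :=
  forall x y : Y, D x -> D y -> `|h x - h y| <= `|x - y|.

Definition has_FPP (R : realType) (Y : completeNormedModType R) : Prop :=
  forall (D : set Y) (h : Y -> Y),
    D !=set0 -> closed D -> convex_set D -> bounded_set D ->
    set_fun D D h -> nonexpansive D h ->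
    exists2 x : Y, D x & h x = x.

(* Main.v *)
Require Import Defs.
From mathcomp Require Import all_boot all_order all_algebra.
From mathcomp Require Import all_classical all_reals all_analysis.
From mathcomp Require Import lra.

Set Implicit Arguments.
Unset Strict Implicit.
Unset Printing Implicit Defensive.

Import Order.TTheory GRing.Theory Num.Theory.
Import numFieldNormedType.Exports.

Local Open Scope classical_set_scope.
Local Open Scope ring_scope.

(** A coincidence point of [T] and [S] is a fixed point of a nonexpansive map.
    The inequality between [S] and [T] says that [S x] depends only on [T x],
    so [h := S o T^-1] is a well-defined nonexpansive self-map of the closed
    convex set [K := range T], and the boundary condition becomes the
    Leray-Schauder condition for [h] about [p := T x0], outside the ball of
    radius [r]: [h y - p] is never a multiple of [y - p] by a factor larger
    than 1.

    The set [K] may be unbounded, so the fixed point property does not apply to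
    it directly; the work is to find inside [K] a bounded piece that [h] maps
    to itself.  For [0 < t < 1] the contraction [y |-> p + t (h y - p)] has a fixed
    point [z] in [K] ([resolvent_point]).  There [h z - p = t^-1 (z - p)], so
    the Leray-Schauder condition keeps [z] within distance [r] of [p], whatever
    [t] is; letting [t] tend to 1 gives approximate fixed points of [h] of
    every precision in that ball ([leray_schauder_approx_fixed]).

    Let [C] be the set of points of [K] from which the approximate fixed points
    in the ball are eventually at distance at most [r], as the precision
    improves ([asymptotic_ball]).  It contains [p], it is closed and convex
    like the sublevel sets of a limsup of distances, and it is bounded because
    approximate fixed points exist.  Finally [h] maps [C] to itself: the
    distance of a point to an approximate fixed point [z] grows under [h] by at
    most the norm of [h z - z].  The fixed point property applied to [C] gives
    the fixed point ([nonexpansive_leray_schauder]). *)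

(** Trades the scalars bundled with a proof that they lie in [[0, 1]] for plain
    ones, so that weights can be computed freely. *)
Lemma convex_combination (R : numDomainType) (M : lmodType R)
    (A : set (convex_lmodType M)) :
  convex_set A <-> forall (x y : M) (t : R), 0 <= t -> t <= 1 -> A x -> A y ->
    A (t *: x + (1 - t) *: y).
Proof.
split=> [cA x y t t0 t1 /mem_set Ax /mem_set Ay|
        cA x y t /set_mem Ax /set_mem Ay].
  have tI : Itv.spec (@Itv.num_sem R) (Itv.Real `[0%Z, 1%Z]) t.
    by rewrite /= /Itv.num_sem /= in_itv/= t0 t1 ger0_real.
  exact/set_mem/(cA x y (Itv.mk tI)).
by apply/mem_set; apply: cA.
Qed.

(** Shrinking a nonexpansive map towards [p] by the factor [t] makes it a
    contraction, and convexity keeps its values in [K]; Banach's theorem then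
    applies even when [K] is unbounded.  The equation is centred at [p] so that
    it compares with the Leray-Schauder condition. *)
Lemma resolvent_point (R : realType) (Y : completeNormedModType R)
    (K : set Y) (h : Y -> Y) (p : Y) (t : R) :
  closed K -> convex_set K -> K p -> set_fun K K h -> nonexpansive K h ->
  0 <= t -> t < 1 ->
  exists2 z, K z & z - p = t *: (h z - p).
Proof.
move=> Kcl /convex_combination Kcv Kp hK hne t0 t1.
pose f y := t *: h y + (1 - t) *: p.
have fB x y : f x - f y = t *: (h x - h y).
  by rewrite /f [t *: h y + _]addrC addrKA scalerBr.
have fK : set_fun K K f.
  by move=> y Ky; apply: Kcv (ltW t1) _ _ => //; exact: hK.
have ctr : is_contraction (mkfun fK).
  exists (NngNum t0); split=> //= -[x y] [/= Kx Ky].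
  rewrite /mkfun fB normrZ ger0_norm// ler_wpM2l//; exact: hne.
have [|z Kz fz] := banach_fixed_point ctr Kcl; first by exists p.
have {}fz : z = f z := fz.
exists z => //; rewrite {1}fz /f scalerBl scale1r scalerBr.
by rewrite -addrA [_ - _ - p]addrAC subrr add0r.
Qed.

Definition approx_fixed (R : realType) (Y : normedModType R)
    (K : set Y) (h : Y -> Y) (p : Y) (r d : R) : set Y :=
  [set z | [/\ K z, `|z - p| <= r & `|h z - z| <= d]].

(** At a resolvent point [z] of parameter [t := 1 - s], the vector [h z - p] is
    [t^-1 > 1] times [z - p], which the Leray-Schauder condition forbids outside
    the ball; so [|z - p| <= r] uniformly in [s], and [h z - z = s (h z - p)]
    tends to 0 with [s]. *)
Lemma leray_schauder_approx_fixed (R : realType) (Y : completeNormedModType R)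
    (K : set Y) (h : Y -> Y) (p : Y) (r d : R) :
  closed K -> convex_set K -> K p -> set_fun K K h -> nonexpansive K h ->
  0 < r ->
  (forall y, K y -> r <= `|y - p| ->
     forall lambda, 1 < lambda -> h y - p <> lambda *: (y - p)) ->
  0 < d -> approx_fixed K h p r d !=set0.
Proof.
move=> Kcl Kcv Kp hK hne r0 ls d0.
(* The bound 1/2 on [s] ensures [|h z - p| <= r / (1 - s) <= 2 r]; the other
   bound then makes [|h z - z| = s |h z - p|] at most [d]. *)
pose s := Num.min (2^-1) (d / (2 * r)).
have s0 : 0 < s by rewrite lt_min invr_gt0 ltr0n divr_gt0// mulr_gt0.
have s12 : s <= 2^-1 by rewrite ge_min lexx.
have sd : s * (2 * r) <= d by rewrite -ler_pdivlMr ?mulr_gt0// ge_min lexx orbT.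
have t0 : 0 < 1 - s by lra.
have [||z Kz zE] := resolvent_point (t := 1 - s) Kcl Kcv Kp hK hne; [lra|lra|].
have hzE : h z - p = (1 - s)^-1 *: (z - p).
  by rewrite zE scalerA mulVf ?scale1r// gt_eqF.
have zr : `|z - p| <= r.
  rewrite leNgt; apply/negP => /ltW /(ls z Kz) /(_ (1 - s)^-1); apply=> //.
  by rewrite invf_gt1//; lra.
exists z; split=> //.
have -> : h z - z = s *: (h z - p).
  rewrite -[in LHS](subrKA p) -[p - z]opprB zE scalerBl scale1r.
  by rewrite opprB addrCA subrr addr0.
rewrite normrZ gtr0_norm// (le_trans _ sd)// ler_pM2l//.
rewrite hzE normrZ gtr0_norm ?invr_gt0//.
rewrite mulrC ler_pdivrMr// (le_trans zr)//; nra.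
Qed.

(** For approximate fixed points given as a sequence [z_n], this would be the
    set [limsup |z_n - y| <= r]; taking all of them at once, filtered by their
    precision [d], avoids choosing a sequence.  The slack [e] replaces the
    limsup. *)
Definition asymptotic_ball (R : realType) (Y : normedModType R)
    (K : set Y) (h : Y -> Y) (p : Y) (r : R) : set Y :=
  [set y | K y /\ forall e, 0 < e -> exists2 d, 0 < d &
     forall z, approx_fixed K h p r d z -> `|z - y| <= r + e].

Section asymptotic_ball.
Context (R : realType) (Y : normedModType R).
Variables (K : set Y) (h : Y -> Y) (p : Y) (r : R).

Let C := asymptotic_ball K h p r.

Lemma asymptotic_ball_base : K p -> C p.
Proof.
move=> Kp; split=> // e e0; exists 1 => // z [_ zr _].
by rewrite (le_trans zr)// lerDl ltW.
Qed.

Lemma asymptotic_ball_closed : closed K -> closed C.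
Proof.
move=> Kcl y Cy; split.
  by apply: Kcl => B /Cy[w [[Kw _] Bw]]; exists w.
move=> e e0; have e20 : 0 < e / 2 by rewrite divr_gt0.
have [w [[_ /(_ _ e20)[d d0 dP]] yw]] := Cy _ (nbhsx_ballx y _ e20).
exists d => // z /dP zw; rewrite -(subrKA w) (le_trans (ler_normD _ _))//.
move: yw; rewrite -ball_normE /= distrC => yw.
by rewrite [e]splitr addrA lerD// ltW.
Qed.

Lemma asymptotic_ball_convex : convex_set K -> convex_set C.
Proof.
move=> /convex_combination Kcv.
apply/convex_combination => x y t t0 t1 [Kx Cx] [Ky Cy].
split; first exact: Kcv.
move=> e e0; have [[d d0 dP] [d' d'0 d'P]] := (Cx _ e0, Cy _ e0).
exists (Num.min d d'); first by rewrite lt_min d0.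
move=> z [Kz zr]; rewrite le_min => /andP[zd zd'].
have zx : `|z - x| <= r + e by exact: dP.
have zy : `|z - y| <= r + e by exact: d'P.
have -> : z - (t *: x + (1 - t) *: y) = t *: (z - x) + (1 - t) *: (z - y).
  rewrite !scalerBr addrACA -scalerDl -opprD.
  by rewrite [t + _]addrC subrK scale1r.
rewrite (le_trans (ler_normD _ _))// !normrZ ger0_norm// ger0_norm ?subr_ge0//.
by nra.
Qed.

(** Without approximate fixed points of every precision the defining condition
    would be vacuous; with them, each point of the set is within [r + 1] of some
    [z] which is itself within [r] of [p]. *)
Lemma asymptotic_ball_bounded :
  (forall d, 0 < d -> approx_fixed K h p r d !=set0) -> bounded_set C.
Proof.
move=> afp; exists (`|p| + (r + (r + 1))); split; first exact: num_real.
move=> M ltM y [_ /(_ 1 ltr01)[d /afp[z zA] dP]].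
rewrite /= (le_trans _ (ltW ltM))//; have [_ zr _] := zA; have zy := dP _ zA.
rewrite -[y](subrK p) addrC (le_trans (ler_normD _ _))// lerD2l.
by rewrite -(subrKA z) addrC (le_trans (ler_normD _ _))// lerD// distrC.
Qed.

(** If [h] almost fixes [z], then [|z - h y|] exceeds [|h z - h y| <= |z - y|]
    by at most [|h z - z|], an error that vanishes as the precision improves. *)
Lemma asymptotic_ball_invariant :
  set_fun K K h -> nonexpansive K h -> set_fun C C h.
Proof.
move=> hK hne y [Ky Cy]; split; first exact: hK.
move=> e e0; have e20 : 0 < e / 2 by rewrite divr_gt0.
have [d d0 dP] := Cy _ e20.
exists (Num.min d (e / 2)); first by rewrite lt_min d0.
move=> z [Kz zr]; rewrite le_min => /andP[zd ze].
have zy : `|z - y| <= r + e / 2 by exact: dP.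
rewrite -(subrKA (h z)) addrC (le_trans (ler_normD _ _))//.
by rewrite [e]splitr addrA lerD ?(le_trans (hne _ _ _ _))// distrC.
Qed.

End asymptotic_ball.

(** Leray-Schauder alternative for nonexpansive maps: in a space with the fixed
    point property, the boundary condition replaces the boundedness of [K]. *)
Lemma nonexpansive_leray_schauder (R : realType) (Y : completeNormedModType R)
    (K : set Y) (h : Y -> Y) (p : Y) (r : R) :
  has_FPP Y ->
  closed K -> convex_set K -> K p -> set_fun K K h -> nonexpansive K h ->
  0 < r ->
  (forall y, K y -> r <= `|y - p| ->
     forall lambda, 1 < lambda -> h y - p <> lambda *: (y - p)) ->
  exists2 y, K y & h y = y.
Proof.
move=> fpp Kcl Kcv Kp hK hne r0 ls.
have [] := fpp (asymptotic_ball K h p r) h.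
- by exists p; exact: asymptotic_ball_base.
- exact: asymptotic_ball_closed.
- exact: asymptotic_ball_convex.
- by apply: asymptotic_ball_bounded => d; exact: leray_schauder_approx_fixed.
- exact: asymptotic_ball_invariant.
- by move=> x y [Kx _] [Ky _]; exact: hne.
- by move=> y [Ky _] hy; exists y.
Qed.

Theorem theorem3p1 (R : realType) (X : Type) (X_nonempty : inhabited X)
    (Y : completeNormedModType R) (Y_FPP : has_FPP Y) (T S : X -> Y)
    (rangeT_closed : closed (range T))
    (rangeT_convex : convex_set (range T))
    (rangeS_sub : range S `<=` range T)
    (S_le_T : forall x y : X, `|S x - S y| <= `|T x - T y|)
    (boundary : exists (x0 : X) (r : R), 0 < r /\
       forall x : X, r <= `|T x - T x0| ->
         forall lambda : R, 1 < lambda ->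
           S x - T x0 <> lambda *: (T x - T x0)) :
  exists x : X, T x = S x.
Proof.
have [x0 [r [r0 bdry]]] := boundary.
(* [g] is a section of [T] over its range; [S \o g] is the induced map. *)
have /choice[g gK] : forall y : Y, exists x : X, range T y -> T x = y.
  move=> y; have [[x _ <-]|ny] := pselect (range T y); first by exists x.
  by exists x0 => /ny.
have [] := @nonexpansive_leray_schauder R Y (range T) (S \o g) (T x0) r Y_FPP.
- exact: rangeT_closed.
- exact: rangeT_convex.
- by exists x0.
- by move=> y _; apply: rangeS_sub; exists (g y).
- by move=> x y Kx Ky; rewrite /= (le_trans (S_le_T _ _))// !gK.
- by [].
- by move=> y Ky; rewrite -{1 3}(gK y Ky); exact: bdry.
- by move=> y Ky /= hy; exists (g y); rewrite gK.
Qed.
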